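(* Let $R$ be any integral domain of positive Krull dimension, not necessarily noetherian, with fraction field $\mathcal Q(R)$. Suppose $R$ is complete with respect to a nontrivial ideal $I$. Then $\operatorname{Ext}^i_R(\mathcal Q(R),R)=0$ for all $i$.
   Context: Nontrivial means $I$ is nonzero and proper. $R$ is complete with respect to $I$ if the natural map $R\to\varprojlim_n R/I^n$ is an isomorphism. *)

(* Defs.v *)
From HB Require Import structures.
From mathcomp Require Import all_boot all_order all_algebra.
From mathcomp Require Import fraction ring_quotient generic_quotient.
From mathcomp Require Import boolp classical_sets functions.

Set Implicit Arguments.
Unset Strict Implicit.
Unset Printing Implicit Defensive.

Import GRing.Theory.
Import Quotient.Exports.
Local Open Scope ring_scope.
Local Open Scope quotient_scope.

(** In [ring_quotient], [idealr] and [prime_idealr] include properness. *)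

(** There is a chain [p 0 < p 1 < ... < p n] of prime ideals of length [n > d],
    i.e. the supremum of the lengths of such chains exceeds [d]. *)
Definition krull_dim_gt (R : comNzRingType) (d : nat) : Prop :=
  exists2 n : nat, (d < n)%N & exists p : nat -> prime_idealr R,
    forall i, (i < n)%N ->
      {subset p i <= p i.+1} /\ exists2 x, x \in p i.+1 & x \notin p i.

Section IdealPower.
Variables (R : comNzRingType) (I : idealr R).

(** [I ^ n] is the ideal generated by the products of [n] elements of [I]; the
    coefficients [t.1] make [I ^ 0] the unit ideal. *)
Definition ideal_pow (n : nat) : {pred R} := fun x =>
  `[< exists2 s : seq (R * n.-tuple R),
        forall t, t \in s -> all [in I] t.2 &
        x = \sum_(t <- s) t.1 * \prod_(y <- t.2) y >].

Lemma ideal_pow_zmod_closed n : zmod_closed (ideal_pow n).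
Proof.
split; first by apply/asboolP; exists [::]; rewrite ?big_nil.
move=> x y /asboolP[s sI ->] /asboolP[s' s'I ->]; apply/asboolP.
exists (s ++ [seq (- t.1, t.2) | t <- s']).
  by move=> t; rewrite mem_cat => /orP[/sI//|/mapP[u /s'I uI ->]].
rewrite big_cat big_map /= -sumrN; congr (_ + _).
by apply: eq_bigr => t _; rewrite mulNr.
Qed.

HB.instance Definition _ n :=
  GRing.isZmodClosed.Build R (ideal_pow n) (ideal_pow_zmod_closed n).

(** [R / I ^ n], as an additive group. *)
Definition quot_pow (n : nat) : zmodType := Quotient.quot (ideal_pow n).

(** The transition map [R / I ^ n -> R / I ^ m] for [m <= n] sends the class of
    [r] to the class of [r]. *)
Definition adic_lim : set (forall n, quot_pow n) :=
  [set x | forall m n, (m <= n)%N -> \pi_(quot_pow m) (repr (x n)) = x m].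

Definition adic_map (r : R) : forall n, quot_pow n := fun n => \pi_(quot_pow n) r.

(** The natural map is additive and multiplicative, so it is an isomorphism onto
    the inverse limit if and only if it is a bijection. *)
Definition adic_complete : Prop := set_bij [set: R] adic_lim adic_map.

End IdealPower.

Section FractionModule.
Variable R : idomainType.
Implicit Types (a b : R) (q : {fraction R}).

Definition frac_scale a q : {fraction R} := tofrac a * q.

Lemma frac_scaleA a b q : frac_scale a (frac_scale b q) = frac_scale (a * b) q.
Proof. by rewrite /frac_scale tofracM mulrA. Qed.

Lemma frac_scale1 : left_id 1 frac_scale.
Proof. by move=> q; rewrite /frac_scale tofrac1 mul1r. Qed.

Lemma frac_scaleDr : right_distributive frac_scale +%R.
Proof. by move=> a q q'; rewrite /frac_scale mulrDr. Qed.

Lemma frac_scaleDl q : {morph frac_scale^~ q : a b / a + b}.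
Proof. by move=> a b; rewrite /frac_scale tofracD mulrDl. Qed.

HB.instance Definition _ := GRing.Zmodule_isLmodule.Build R {fraction R}
  frac_scaleA frac_scale1 frac_scaleDr frac_scaleDl.

End FractionModule.

Section Hom.
Variables (R : comNzRingType) (U V : lmodType R).

Definition LinHom := {linear U -> V}.

Lemma LinHom_eq (f g : LinHom) : (forall u, f u = g u) -> f = g.
Proof.
move=> fg; have {}fg : f = g :> (U -> V) by apply/funext.
case: f g fg => [f [[f1] [f2]]] [g [[g1] [g2]]] /= fg.
by subst g; rewrite (Prop_irrelevance f1 g1) (Prop_irrelevance f2 g2).
Qed.

HB.instance Definition _ := gen_eqMixin LinHom.
HB.instance Definition _ := gen_choiceMixin LinHom.

Definition LinHom_zero : LinHom := \0.
Definition LinHom_add (f g : LinHom) : LinHom := f \+ g.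
Definition LinHom_opp (f : LinHom) : LinHom := \- f.

Lemma LinHom_addA : associative LinHom_add.
Proof. by move=> f g h; apply: LinHom_eq => u /=; rewrite addrA. Qed.

Lemma LinHom_addC : commutative LinHom_add.
Proof. by move=> f g; apply: LinHom_eq => u /=; rewrite addrC. Qed.

Lemma LinHom_add0 : left_id LinHom_zero LinHom_add.
Proof. by move=> f; apply: LinHom_eq => u /=; rewrite add0r. Qed.

Lemma LinHom_addN : left_inverse LinHom_zero LinHom_opp LinHom_add.
Proof. by move=> f; apply: LinHom_eq => u /=; rewrite addNr. Qed.

HB.instance Definition _ :=
  GRing.isZmodule.Build LinHom LinHom_addA LinHom_addC LinHom_add0 LinHom_addN.

End Hom.

Definition projective (R : comNzRingType) (P : lmodType R) : Prop :=
  forall (A B : lmodType R) (g : {linear A -> B}) (h : {linear P -> B}),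
    (forall b, exists a, g a = b) ->
    exists k : {linear P -> A}, forall p, g (k p) = h p.

(** An exact sequence [... -> P 1 -> P 0 -> M -> 0] with every [P n] projective. *)
Record proj_resolution (R : comNzRingType) (M : lmodType R) := ProjResolution {
  res_mod :> nat -> lmodType R;
  res_diff : forall n, {linear res_mod n.+1 -> res_mod n};
  res_aug : {linear res_mod 0%N -> M};
  res_projective : forall n, projective (res_mod n);
  res_aug_surj : forall m, exists p, res_aug p = m;
  res_exact0 : forall p, res_aug p = 0 <-> exists q, res_diff 0%N q = p;
  res_exactS : forall n p,
    res_diff n p = 0 <-> exists q, res_diff n.+1 q = p
}.

Section Ext.
Variables (R : comNzRingType) (M : lmodType R) (P : proj_resolution M).
Variables (N : lmodType R) (i : nat).

Definition is_cocycle : {pred LinHom (P i) N} :=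
  fun f => `[< forall p, f (res_diff P i p) = 0 >].

Lemma is_cocycle_zmod_closed : zmod_closed is_cocycle.
Proof.
split=> [|f g /asboolP Zf /asboolP Zg]; apply/asboolP => p //=.
by rewrite Zf Zg subr0.
Qed.

HB.instance Definition _ :=
  GRing.isZmodClosed.Build (LinHom (P i) N) is_cocycle is_cocycle_zmod_closed.

Record cocycle := Cocycle { cochain :> LinHom (P i) N; _ : cochain \in is_cocycle }.

HB.instance Definition _ := [isSub for cochain].
HB.instance Definition _ := [Choice of cocycle by <:].
HB.instance Definition _ := [SubChoice_isSubZmodule of cocycle by <:].

(** The complex is [0] in degree [-1], so that only [0] is a coboundary in
    degree [0]. *)
Definition is_coboundary : {pred cocycle} :=
  fun f => `[< match i return LinHom (P i) N -> Prop with
               | 0 => fun f => f = 0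
               | j.+1 => fun f => exists g : LinHom (P j) N,
                                    forall p, f p = g (res_diff P j p)
               end (cochain f) >].

Lemma is_coboundary_zmod_closed : zmod_closed is_coboundary.
Proof.
split=> [|f g].
  apply/asboolP; have -> : cochain 0 = 0 by [].
  by case: i => // j; exists 0.
move=> /asboolP Bf /asboolP Bg; apply/asboolP; move: Bf Bg.
have -> : cochain (f - g) = cochain f - cochain g by [].
move: (cochain f) (cochain g); case: i => [_ _ -> ->|j f' g' [a f'a] [b g'b]].
  by rewrite subr0.
by exists (a - b) => p /=; rewrite f'a g'b.
Qed.

HB.instance Definition _ :=
  GRing.isZmodClosed.Build cocycle is_coboundary is_coboundary_zmod_closed.

(** [Ext^i_R(M, N)], computed from the projective resolution [P] of [M]: the
    [i]-th cohomology group of the complex [Hom(P, N)]. *)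
Definition Ext : zmodType := Quotient.quot is_coboundary.

End Ext.

Section FreeModule.
Variables (R : comNzRingType) (X : choiceType).

Definition finsupp : {pred X -> R^o} :=
  fun f => `[< exists s : seq X, forall x, f x != 0 -> x \in s >].

Lemma finsupp_submod_closed : submod_closed finsupp.
Proof.
split=> [|a f g /asboolP[s fs] /asboolP[t gt]]; apply/asboolP.
  by exists [::] => x; rewrite eqxx.
exists (s ++ t) => x; rewrite mem_cat.
apply: contraR; rewrite negb_or => /andP[xs xt].
have /eqP f0 : f x == 0 by apply: contraNT xs; apply: fs.
have /eqP g0 : g x == 0 by apply: contraNT xt; apply: gt.
by rewrite -[_ x]/(a *: f x + g x) f0 g0 scaler0 addr0.
Qed.

HB.instance Definition _ :=
  GRing.isSubmodClosed.Build R (X -> R^o) finsupp finsupp_submod_closed.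

Record free_mod := FreeMod { coeffs :> X -> R^o; _ : coeffs \in finsupp }.

HB.instance Definition _ := [isSub for coeffs].
HB.instance Definition _ := [Choice of free_mod by <:].
HB.instance Definition _ := [SubChoice_isSubLmodule of free_mod by <:].

Lemma coeffsP a (f g : free_mod) x : (a *: f + g) x = a * f x + g x.
Proof. by []. Qed.

Lemma free_eq (f g : free_mod) : (forall x, f x = g x) -> f = g.
Proof. by move=> fg; apply/val_inj/funext. Qed.

Lemma supp_ex (f : free_mod) : exists s : seq X, forall x, f x != 0 -> x \in s.
Proof. by case: f => f /= /asboolP. Qed.

Definition supp (f : free_mod) : seq X := undup (projT1 (cid (supp_ex f))).

Lemma mem_supp (f : free_mod) x : f x != 0 -> x \in supp f.
Proof. by rewrite mem_undup; case: cid => s /= /(_ x). Qed.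

Section Lift.
Variables (V : lmodType R) (h : X -> V).

Definition free_lift (f : free_mod) : V := \sum_(x <- supp f) f x *: h x.

Lemma free_liftE (f : free_mod) (s : seq X) : uniq s ->
  (forall x, f x != 0 -> x \in s) -> free_lift f = \sum_(x <- s) f x *: h x.
Proof.
have nz (r : seq X) :
    \sum_(x <- r) f x *: h x = \sum_(x <- [seq x <- r | f x != 0]) f x *: h x.
  rewrite big_filter [RHS]big_mkcond; apply: eq_bigr => x _.
  by case: eqP => // ->; rewrite scale0r.
move=> us fs; rewrite /free_lift nz [RHS]nz; apply: perm_big.
apply: uniq_perm; rewrite ?filter_uniq ?undup_uniq // => x.
rewrite !mem_filter; case: (boolP (f x == 0)) => //= fx.
by rewrite mem_supp // fs.
Qed.

Lemma free_lift_is_linear : linear free_lift.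
Proof.
move=> a f g; set s := undup (supp f ++ supp g ++ supp (a *: f + g)).
rewrite !(@free_liftE _ s) ?undup_uniq //; last 3 first.
- by move=> x /mem_supp xg; rewrite mem_undup !mem_cat xg orbT.
- by move=> x /mem_supp xf; rewrite mem_undup !mem_cat xf.
- by move=> x /mem_supp xfg; rewrite mem_undup !mem_cat xfg !orbT.
rewrite scaler_sumr -big_split; apply: eq_bigr => x _ /=.
by rewrite scalerA -scalerDl.
Qed.

HB.instance Definition _ :=
  GRing.isLinear.Build R free_mod V *:%R free_lift free_lift_is_linear.

End Lift.

Lemma delta_subproof (x : X) : (fun y => (y == x)%:R : R^o) \in finsupp.
Proof.
apply/asboolP; exists [:: x] => y; rewrite inE.
by apply: contraR => /negPf ->.
Qed.

Definition delta (x : X) : free_mod := FreeMod (delta_subproof x).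

Lemma free_liftU (V : lmodType R) (h : X -> V) x : free_lift h (delta x) = h x.
Proof.
rewrite (@free_liftE _ _ _ [:: x]) //; last first.
  by move=> y /=; rewrite inE; apply: contraR => /negPf ->.
by rewrite big_seq1 /= eqxx scale1r.
Qed.

Lemma free_expand (f : free_mod) : f = \sum_(x <- supp f) f x *: delta x.
Proof.
apply: free_eq => y.
have coeffs_sum (s : seq X) :
    (\sum_(x <- s) f x *: delta x) y = \sum_(x <- s) f x * (y == x)%:R.
  elim: s => [|x s IHs]; first by rewrite !big_nil.
  by rewrite !big_cons coeffsP IHs.
rewrite coeffs_sum; have [fy|/mem_supp ys] := eqVneq (f y) 0.
  rewrite fy big1 // => x _; case: eqP => [<-|_]; last by rewrite mulr0.
  by rewrite fy mul0r.
rewrite (bigD1_seq y) ?undup_uniq //= eqxx mulr1 big1 ?addr0 // => x.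
by rewrite eq_sym => /negPf ->; rewrite mulr0.
Qed.

Lemma free_projective : projective free_mod.
Proof.
move=> A B g h g_surj.
pose k0 x := projT1 (cid (g_surj (h (delta x)))).
have gk0 x : g (k0 x) = h (delta x) by rewrite /k0; case: cid.
exists (free_lift k0) => f; rewrite [in RHS](free_expand f) /free_lift !linear_sum.
by apply: eq_bigr => x _; rewrite !linearZ /= gk0.
Qed.

End FreeModule.

Section FreeResolution.
Variable R : comNzRingType.

(** [syz M] is the kernel of the canonical surjection onto [M] from the free
    module on the set [M]. *)
Section Syzygy.
Variable M : lmodType R.

Definition free_cover : free_mod R M -> M := free_lift id.

HB.instance Definition _ := GRing.Linear.on free_cover.

Definition in_syz : {pred free_mod R M} := fun f => free_cover f == 0.

Lemma in_syz_submod_closed : submod_closed in_syz.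
Proof.
split=> [|a f g /eqP f0 /eqP g0]; apply/eqP; first by rewrite linear0.
by rewrite linearP /= f0 g0 scaler0 addr0.
Qed.

HB.instance Definition _ :=
  GRing.isSubmodClosed.Build R (free_mod R M) in_syz in_syz_submod_closed.

Record syz := Syz { syz_val : free_mod R M; _ : syz_val \in in_syz }.

HB.instance Definition _ := [isSub for syz_val].
HB.instance Definition _ := [Choice of syz by <:].
HB.instance Definition _ := [SubChoice_isSubLmodule of syz by <:].
HB.instance Definition _ := GRing.Linear.copy syz_val (\val : syz -> _).

End Syzygy.

Lemma free_cover_surj (M : lmodType R) (m : M) : exists p, free_cover p = m.
Proof. by exists (delta R m); exact: free_liftU. Qed.

Variable M : lmodType R.

Definition syzygy (n : nat) : lmodType R := iter n (fun K => syz K : lmodType R) M.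

Definition free_res_mod (n : nat) : lmodType R := free_mod R (syzygy n).

Definition free_res_diff (n : nat) :
    {linear free_res_mod n.+1 -> free_res_mod n} :=
  @syz_val (syzygy n) \o @free_cover (syzygy n.+1).

Lemma free_res_exact n (p : free_res_mod n) :
  free_cover p = 0 <-> exists q, free_res_diff n q = p.
Proof.
split=> [/eqP p0|[q <-]]; last by apply/eqP; exact: (valP (free_cover q)).
have [q qE] := @free_cover_surj (syzygy n.+1) (Syz p0).
by exists q; rewrite /= qE.
Qed.

Lemma free_res_exactS n (p : free_res_mod n.+1) :
  free_res_diff n p = 0 <-> exists q, free_res_diff n.+1 q = p.
Proof.
rewrite -free_res_exact; split=> [p0|/= ->]; last by rewrite linear0.
by apply: val_inj; rewrite [RHS]raddf0.
Qed.

(** Quantifying over the projective resolutions of [M] is thus never vacuous. *)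
Definition free_resolution : proj_resolution M :=
  @ProjResolution R M free_res_mod free_res_diff (@free_cover (syzygy 0))
    (fun n => @free_projective R (syzygy n)) (@free_cover_surj M)
    (@free_res_exact 0) free_res_exactS.

End FreeResolution.

(* Main.v *)
Require Import Defs.
From HB Require Import structures.
From mathcomp Require Import all_boot all_order all_algebra.
From mathcomp Require Import fraction ring_quotient generic_quotient.
From mathcomp Require Import boolp classical_sets.

Set Implicit Arguments.
Unset Strict Implicit.
Unset Printing Implicit Defensive.

Import GRing.Theory.
Import Quotient.Exports.
Local Open Scope ring_scope.
Local Open Scope quotient_scope.

(** Let [x != 0] lie in [I]. By completeness the equations
    [y n - x * y n.+1 = z n] have a unique solution [y] in [R] for every [z],
    namely [y n = \sum_k x ^+ k * z (n + k)]; no finiteness of [I] is needed.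
    This property passes to the complex [Hom(P, R)] and to its cohomology
    [H = Ext^i(Q, R)]. On the other hand [x] acts invertibly on [Q], hence on [H],
    so that any [h] in [H] starts a sequence with [h n = x * h n.+1], and
    uniqueness forces [h = 0]. *)

(** * Lifting from projective modules, and telescoping systems *)

Section Image.
Variables (R : comNzRingType) (A B : lmodType R) (d : {linear A -> B}).

Definition in_lin_image : {pred B} := fun b => `[< exists a, d a = b >].

Lemma in_lin_image_submod_closed : submod_closed in_lin_image.
Proof.
split=> [|c _ _ /asboolP[a <-] /asboolP[b <-]]; apply/asboolP.
  by exists 0; rewrite linear0.
by exists (c *: a + b); rewrite linearP.
Qed.

HB.instance Definition _ :=
  GRing.isSubmodClosed.Build R B in_lin_image in_lin_image_submod_closed.

Record lin_image :=
  LinImage { lin_image_val : B; _ : lin_image_val \in in_lin_image }.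

HB.instance Definition _ := [isSub for lin_image_val].
HB.instance Definition _ := [Choice of lin_image by <:].
HB.instance Definition _ := [SubChoice_isSubLmodule of lin_image by <:].

(** [d] need not be surjective: projectivity is applied to its corestriction onto the image, through
    which [h] factors. *)
Lemma projective_lift (P : lmodType R) (h : {linear P -> B}) :
  projective P -> (forall p, exists a, d a = h p) ->
  exists k : {linear P -> A}, forall p, d (k p) = h p.
Proof.
move=> projP hd.
have inA a : d a \in in_lin_image by apply/asboolP; exists a.
have inP p : h p \in in_lin_image by apply/asboolP.
pose d' a := LinImage (inA a); pose h' p := LinImage (inP p).
have d'_lin : linear d' by move=> c a b; apply: val_inj; rewrite /= linearP.
have h'_lin : linear h' by move=> c a b; apply: val_inj; rewrite /= linearP.
pose Ld := GRing.isLinear.Build R A lin_image *:%R d' d'_lin.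
pose Lh := GRing.isLinear.Build R P lin_image *:%R h' h'_lin.
pose dL : {linear A -> lin_image} := HB.pack d' Ld.
pose hL : {linear P -> lin_image} := HB.pack h' Lh.
have [b|k kE] := projP _ _ dL hL.
  by have /asboolP[a ab] := valP b; exists a; apply: val_inj.
by exists k => p; have /(congr1 val) := kE p.
Qed.

End Image.

(** By the telescope resolution of [R[1/x]], this says that [Hom(R[1/x], N)] and [Ext^1(R[1/x], N)]
    vanish. *)
Definition telescoping (R : comNzRingType) (x : R) (N : lmodType R) : Prop :=
  (forall z : nat -> N, exists y, forall n, y n - x *: y n.+1 = z n) /\
  (forall y : nat -> N, (forall n, y n = x *: y n.+1) -> forall n, y n = 0).

(** The equations are solved pointwise; the solutions are linear because their defect of linearity
    solves the homogeneous system, hence vanishes. *)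
Lemma telescoping_LinHom (R : comNzRingType) (x : R) (U N : lmodType R)
    (g : nat -> {linear U -> N}) :
  telescoping x N ->
  exists u : nat -> {linear U -> N},
    forall n p, u n p - x *: u n.+1 p = g n p.
Proof.
move=> [ex un].
pose v p := projT1 (cid (ex (fun n => g n p))).
have vE p n : v p n - x *: v p n.+1 = g n p by rewrite /v; case: cid.
have v_lin n : linear (v^~ n).
  move=> c p q; apply/eqP; rewrite -subr_eq0; apply/eqP.
  apply: (un (fun n => v (c *: p + q) n - (c *: v p n + v q n))) => {}n /=.
  apply/eqP; rewrite -subr_eq0 scalerBr opprB [X in _ + X]addrC addrACA.
  rewrite vE linearP -!vE [- _ + _]addrC -[X in _ + X]opprB.
  rewrite scalerBr !scalerDr !scalerA [c * x]mulrC.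
  by rewrite [X in X - _]addrACA -opprD subrr.
pose L n := GRing.isLinear.Build R U N *:%R (v^~ n) (v_lin n).
exists (fun n => HB.pack_for {linear U -> N} (v^~ n) (L n)) => n p; exact: vE.
Qed.

(** * Division by [x] on a projective resolution *)

Section Resolution.
Variables (R : comNzRingType) (M : lmodType R) (P : proj_resolution M).
Variables (x : R) (div : {linear M -> M}).
Hypothesis divK : forall m, x *: div m = m.

(* [phi] and [s] are the degree-[n] parts of a chain map lifting division by [x]
   and of a homotopy from the identity to [x *: phi]; the first two clauses are
   what extending them to degree [n + 1] requires. *)
Lemma lift_division n :
  exists (phi : {linear P n -> P n}) (s : {linear P n -> P n.+1}),
    [/\ forall q, exists r, res_diff P n r = phi (res_diff P n q),
        forall q, x *: phi (res_diff P n q) - res_diff P n q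
                  = res_diff P n (s (res_diff P n q))
      & match n return {linear P n -> P n} -> {linear P n -> P n.+1} -> Prop with
        | 0 => fun phi s =>
            forall p, x *: phi p - p = res_diff P 0 (s p)
        | m.+1 => fun phi s => exists s' : {linear P m -> P m.+1},
            forall p, x *: phi p - p
                      = res_diff P m.+1 (s p) + s' (res_diff P m p)
        end phi s].
Proof.
elim: n => [|n [phi [s [phi_d s_d _]]]].
  have [|phi phiE] := @projective_lift _ _ _ (res_aug P) _ (div \o res_aug P)
    (@res_projective _ _ P 0); first by move=> p; exact: res_aug_surj.
  (* Since [x *: div] is the identity, the augmentation kills [x *: phi - id], which therefore lifts
     through the first differential. *)
  have [|s sE] := @projective_lift _ _ _ (res_diff P 0) _ (x \*: phi \- idfun)
    (@res_projective _ _ P 0).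
    move=> p; apply/res_exact0.
    by rewrite /= linearB linearZ /= phiE /= divK subrr.
  exists phi, s; split=> [q|q|p]; rewrite ?sE //.
  apply/res_exact0; rewrite phiE /=.
  have -> : res_aug P (res_diff P 0 q) = 0 by apply/res_exact0; exists q.
  exact: linear0.
have dd q : res_diff P n (res_diff P n.+1 q) = 0 by apply/res_exactS; exists q.
have [//|phi' phi'E] := @projective_lift _ _ _ (res_diff P n) _
  (phi \o res_diff P n) (@res_projective _ _ P n.+1).
(* By the second inductive clause, what remains after subtracting [s \o d] is a cycle, so exactness
   supplies the next homotopy. *)
have [|s' s'E] := @projective_lift _ _ _ (res_diff P n.+1) _
  ((x \*: phi' \- idfun) \- (s \o res_diff P n)) (@res_projective _ _ P n.+1).
  move=> p; apply/res_exactS.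
  by rewrite /= !linearB linearZ /= phi'E /= s_d subrr.
exists phi', s'; split=> [q|q|].
- by apply/res_exactS; rewrite phi'E /= dd linear0.
- by rewrite s'E /= dd linear0 subr0.
by exists s => p; rewrite s'E /= subrK.
Qed.

End Resolution.

(** * Division by [x] on cohomology, and vanishing of [Ext] *)

Lemma cohomologous_division (R : comNzRingType) (M N : lmodType R)
    (P : proj_resolution M) (x : R) (div : {linear M -> M}) (i : nat) :
  (forall m, x *: div m = m) ->
  exists phi : {linear P i -> P i},
    forall f : {linear P i -> N}, (forall q, f (res_diff P i q) = 0) ->
    (forall q, f (phi (res_diff P i q)) = 0) /\
    match i return ({linear P i -> N}) -> ({linear P i -> P i}) -> Prop with
    | 0 => fun f phi => forall p, f p = x *: f (phi p)
    | j.+1 => fun f phi => exists g : {linear P j -> N},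
        forall p, f p - x *: f (phi p) = g (res_diff P j p)
    end f phi.
Proof.
move=> divK; have [phi [s [phi_d _ hom]]] := lift_division P divK i.
(* In the homotopy formula the cocycle [f] kills the term with [s]. The other term gives a
   coboundary, and is absent in degree 0. *)
exists phi => f fd; split=> [q|]; first by have [r <-] := phi_d q.
case: i phi s f hom fd {phi_d} => [|j] phi s f hom fd.
  by move=> p; apply/esym/eqP; rewrite -subr_eq0 -linearZ -linearB /= hom fd.
have [s' s'E] := hom; exists (\- (f \o s')) => p /=.
by rewrite -linearZ -linearB /= -opprB s'E linearN linearD /= fd add0r.
Qed.

Lemma Ext_telescoping_eq0 (R : comNzRingType) (M N : lmodType R)
    (P : proj_resolution M) (x : R) (div : {linear M -> M}) (i : nat)
    (e : Ext P N i) :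
  (forall m, x *: div m = m) -> telescoping x N -> e = 0.
Proof.
move=> divK telN; rewrite -[e]reprK; apply/eqP.
rewrite piE Quotient.equivE subr0; move: (repr e) => {e} [f fZ].
have fd q : f (res_diff P i q) = 0 by move/asboolP: (fZ).
have [phi phiP] := cohomologous_division N P i divK.
(* [F n] is a cocycle representing the class of [f] divided by [x ^+ n]. *)
pose F n : {linear P i -> N} :=
  iter n (fun h : {linear P i -> N} => h \o phi) f.
have Fd n q : F n (res_diff P i q) = 0.
  by elim: n q => [|n IHn] q; [exact: fd | exact: (phiP _ IHn).1].
have {}phiP n := (phiP (F n) (Fd n)).2.
apply/asboolP => /=.
case: i phi f @F {fZ fd Fd} phiP => [|j] phi f F phiP.
  apply: LinHom_eq => p; exact: (telN.2 (fun n => F n p) (fun n => phiP n p) 0).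
pose g n := projT1 (cid (phiP n)).
have gE n p : F n p - x *: F n.+1 p = g n (res_diff P j p).
  by rewrite /g; case: cid.
(* Correcting each [F n] by the coboundary of [u n] turns the relations modulo coboundaries into
   equalities; uniqueness then kills the corrected sequence, so [f] is the coboundary of [u 0]. *)
have [u uE] := telescoping_LinHom g telN.
exists (u 0) => p; apply/eqP; rewrite -subr_eq0; apply/eqP.
apply: (telN.2 (fun n => F n p - u n (res_diff P j p)) _ 0) => n.
apply/eqP; rewrite -subr_eq0 scalerBr opprB [X in _ + X]addrC addrACA.
by rewrite gE [- _ + _]addrC -[X in _ + X]opprB uE subrr.
Qed.

(** * Telescoping systems over an adically complete ring *)

Section Adic.
Variables (R : comNzRingType) (I : idealr R).

Lemma ideal_powM n a y : y \in ideal_pow I n -> a * y \in ideal_pow I n.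
Proof.
move=> /asboolP[s sI ->]; apply/asboolP.
exists [seq (a * t.1, t.2) | t <- s]; first by move=> _ /mapP[t /sI tI ->].
by rewrite big_map mulr_sumr; apply: eq_bigr => t _; rewrite mulrA.
Qed.

Lemma exp_ideal_pow x n : x \in I -> x ^+ n \in ideal_pow I n.
Proof.
move=> xI; apply/asboolP; exists [:: (1, nseq_tuple n x)].
  by move=> t; rewrite inE => /eqP -> /=; rewrite all_nseq xI orbT.
by rewrite big_seq1 mul1r /= big_nseq -Monoid.iteropE.
Qed.

(** One factor of each product is absorbed into its coefficient. *)
Lemma ideal_powS n y : y \in ideal_pow I n.+1 -> y \in ideal_pow I n.
Proof.
move=> /asboolP[s sI ->]; apply/asboolP.
exists [seq (t.1 * thead t.2, [tuple of behead t.2]) | t <- s].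
  move=> _ /mapP[[a t] /sI /= tI ->] /=.
  by case/tupleP: t tI => b t /= /andP[].
rewrite big_map; apply: eq_bigr => -[a t] _ /=.
by case/tupleP: t => b t; rewrite big_cons theadE mulrA.
Qed.

Lemma ideal_pow_le m n y :
  (m <= n)%N -> y \in ideal_pow I n -> y \in ideal_pow I m.
Proof.
by move=> /subnK <-; elim: (n - m)%N => // k IHk /ideal_powS.
Qed.

Hypothesis I_complete : adic_complete I.

Lemma adic_separated y : (forall n, y \in ideal_pow I n) -> y = 0.
Proof.
move=> yI; have [_ inj _] := I_complete.
apply: inj; rewrite ?inE //; apply: functional_extensionality_dep => n.
apply/eqP; rewrite -Quotient.idealrBE subr0; exact: yI.
Qed.

Lemma adic_limit (s : nat -> R) :
  (forall m n, (m <= n)%N -> s n - s m \in ideal_pow I m) ->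
  exists y, forall n, y - s n \in ideal_pow I n.
Proof.
move=> sI; have [_ _ surj] := I_complete.
have [|y _ yE] := surj (fun n => \pi_(quot_pow I n) (s n)).
  move=> m n mn; apply/eqP; rewrite -Quotient.idealrBE.
  rewrite -[repr _](subrK (s n)) -addrA rpredD ?sI //.
  apply: (ideal_pow_le mn); rewrite Quotient.idealrBE; apply/eqP; exact: reprK.
exists y => n; rewrite Quotient.idealrBE; apply/eqP.
exact: (congr1 (fun h => h n) yE).
Qed.

Lemma adic_telescoping x : x \in I -> telescoping x R^o.
Proof.
move=> xI; split=> [|y yE n]; last first.
  apply: adic_separated => k.
  (* Iterating the homogeneous equation puts [y n] in every power of [I]. *)
  have -> : y n = y (n + k)%N * x ^+ k.
    elim: k => [|k IHk]; first by rewrite addn0 mulr1.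
    by rewrite IHk yE addnS exprS [RHS]mulrCA [RHS]mulrA.
  exact/ideal_powM/exp_ideal_pow.
suff sol (z : nat -> R) :
    exists y : nat -> R, forall n, y n - x * y n.+1 = z n by exact: sol.
(* The partial sum with [m] terms of the series for [y n]. *)
pose s n m := \sum_(k < m) z (n + k)%N * x ^+ k.
have sI n m k : (m <= k)%N -> s n k - s n m \in ideal_pow I m.
  move=> /subnKC <-; elim: (k - m)%N => [|l IHl].
    by rewrite addn0 subrr rpred0.
  rewrite addnS /s big_ord_recr /= addrAC rpredD //.
  apply/ideal_powM/(ideal_pow_le (leq_addr l m)); exact: exp_ideal_pow.
have sS n m : s n m.+1 = z n + x * s n.+1 m.
  rewrite /s big_ord_recl addn0 mulr1 mulr_sumr; congr (_ + _).
  by apply: eq_bigr => k _; rewrite lift0 addnS -addSn exprS mulrCA.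
pose y n := projT1 (cid (adic_limit (sI n))).
have yE n m : y n - s n m \in ideal_pow I m by rewrite /y; case: cid.
exists y => n; apply/eqP; rewrite -subr_eq0; apply/eqP.
apply: adic_separated => m.
(* The partial sums have lengths [m.+1] and [m], because splitting off [z n] uses up one term. *)
have -> : y n - x * y n.+1 - z n
          = (y n - s n m.+1) - x * (y n.+1 - s n.+1 m).
  by rewrite sS mulrBr opprB opprD !addrA subrK addrAC.
rewrite rpredB //; first exact/ideal_powS/yE.
exact/ideal_powM/yE.
Qed.

End Adic.

(** * Division by [x] on the fraction field *)

Lemma tofrac_div_linear (R : idomainType) (x : R) :
  linear (fun q : {fraction R} => (tofrac x)^-1 * q).
Proof.
by move=> a p q; rewrite mulrDr /GRing.scale /= /frac_scale mulrCA.
Qed.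

Theorem mainTheorem12 (R : idomainType) (I : idealr R)
    (dimR : krull_dim_gt R 0)
    (I_neq0 : exists2 x : R, x \in I & x != 0)
    (R_complete : adic_complete I)
    (P : proj_resolution {fraction R}) (i : nat) (e : Ext P R^o i) :
  e = 0.
Proof.
have [x xI x0] := I_neq0.
pose L := GRing.isLinear.Build R {fraction R} {fraction R} *:%R _
  (tofrac_div_linear x).
pose div := HB.pack_for {linear {fraction R} -> {fraction R}}
  (fun q : {fraction R} => (tofrac x)^-1 * q) L.
apply: (@Ext_telescoping_eq0 _ _ _ P x div); last exact: adic_telescoping xI.
by move=> q; apply: mulVKf; rewrite tofrac_eq0.
Qed.
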